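(* For any $d \in \mathbb{N}$, there exists an algebraic number $\alpha \in \mathbb{C}$ such that the monoid $M_\alpha$ is an antimatter valuation monoid of rank $d$ that is not a group.
   Context: $\mathbb{N} = \{1,2,\dots\}$, $\mathbb{N}_0 = \mathbb{N}\cup\{0\}$. For $\alpha \in \mathbb{C}$, $M_\alpha := \{p(\alpha) : p(x) \in \mathbb{N}_0[x]\}$, viewed as a (cancellative commutative) monoid under addition, where $\mathbb{N}_0[x]$ is the set of polynomials with nonnegative integer coefficients. For an additively written monoid $M$ and $a,b \in M$, $b \mid_M a$ means $a = b + c$ for some $c \in M$; $M$ is a valuation monoid if for all $a,b \in M$ either $a \mid_M b$ or $b \mid_M a$. An atom of $M$ is a non-invertible element $a \in M$ such that $a = b+c$ with $b,c \in M$ implies that $b$ or $c$ is invertible in $M$; $M$ is antimatter if it has no atoms. The rank of a monoid is the rank (as a $\mathbb{Z}$-module) of its Grothendieck (difference) group; for $M_\alpha$ with $\alpha$ algebraic this is the dimension over $\mathbb{Q}$ of the $\mathbb{Q}$-span of $M_\alpha$ in $\mathbb{C}$. *)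

(* Defs.v *)
From HB Require Import structures.
From mathcomp Require Import all_boot all_order all_algebra.
From mathcomp Require Import complex.
From mathcomp Require Import boolp classical_sets reals.

Set Implicit Arguments.
Unset Strict Implicit.
Unset Printing Implicit Defensive.

Import Order.TTheory GRing.Theory Num.Theory.

Local Open Scope classical_set_scope.
Local Open Scope ring_scope.

(* Cancellative commutative monoids are taken as additive submonoids of an
   ambient abelian group V; subtraction in V is only used to form the
   difference group and never to leave M in the monoid notions. *)
Section Monoids.
Variable V : zmodType.
Implicit Types (M G : set V) (a b c : V).

Definition submonoid M : Prop :=
  M 0 /\ forall a b, M a -> M b -> M (a + b).

Definition mdvd M b a : Prop := exists2 c, M c & a = b + c.

Definition valuation_monoid M : Prop :=
  forall a b, M a -> M b -> mdvd M b a \/ mdvd M a b.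

Definition minvertible M a : Prop := M a /\ exists2 b, M b & a + b = 0.

Definition matom M a : Prop :=
  [/\ M a, ~ minvertible M a &
      forall b c, M b -> M c -> a = b + c -> minvertible M b \/ minvertible M c].

Definition antimatter M : Prop := forall a, ~ matom M a.

Definition is_group M : Prop := forall a, M a -> minvertible M a.

(* As M is a submonoid of the group V, its Grothendieck group is (canonically
   isomorphic to) the subgroup of differences of elements of M. *)
Definition difference_group M : set V := [set a - b | a in M & b in M].

Definition Zfree (n : nat) (v : 'I_n -> V) : Prop :=
  forall k : 'I_n -> int, \sum_(i < n) v i *~ k i = 0 -> forall i, k i = 0.

Definition has_Zrank G (d : nat) : Prop :=
  (exists2 v : 'I_d -> V, (forall i, G (v i)) & Zfree v) /\
  (forall (n : nat) (v : 'I_n -> V),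
     (forall i, G (v i)) -> Zfree v -> (n <= d)%N).

Definition has_rank M (d : nat) : Prop := has_Zrank (difference_group M) d.

End Monoids.

Definition evaluation_monoid (C : nzRingType) (alpha : C) : set C :=
  [set (map_poly (fun n : nat => n%:R : C) p).[alpha] | p in [set: {poly nat}]].

Lemma submonoid_evaluation_monoid (C : nzRingType) (alpha : C) :
  submonoid (evaluation_monoid alpha).
Proof.
split=> [|_ _ [p _ <-] [q _ <-]]; first by exists 0; rewrite // map_poly0 horner0.
exists (p + q) => //; rewrite -hornerD; congr (_.[_]); apply/polyP => i.
by rewrite coefD !coef_map_id0 ?coefD ?natrD.
Qed.

(* Main.v *)
(** Let [a] be the positive real with [1 = 2 (a + a^2 + ... + a^d)]. Its inverse
    is a root of the Eisenstein polynomial [X^d - 2 X^(d-1) - ... - 2], so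
    [Z[a]], the difference group, has rank [d]. Multiplying the equation by
    [a^j] splits [a^j] into two nonzero elements of [M_a], so there are no
    atoms. The same equation rewrites an integer combination of
    [a^k, ..., a^(k+d-1)] as one of [a^(k+1), ..., a^(k+d)] through a
    nonnegative matrix, and a Perron-Frobenius argument shows that the
    coefficients of a positive real eventually become nonnegative. Hence [M_a]
    is the set of nonnegative elements of [Z[a]], which makes it a valuation
    monoid. *)

Require Import Defs.
From mathcomp Require Import all_boot all_order all_algebra.
From mathcomp Require Import complex.
From mathcomp Require Import boolp classical_sets reals.
From mathcomp Require Import ring lra.

Set Implicit Arguments.
Unset Strict Implicit.
Unset Printing Implicit Defensive.

Import Order.TTheory GRing.Theory Num.Theory.

Local Open Scope ring_scope.

(** * Integer coordinates with respect to powers of [a] *)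

(** The constant term [v 0] is replaced by [v 0 * 2 (a + ... + a^(n+1))] and one factor [a] is taken
    out. Nothing moves down into the top index [n], hence the 0. *)
Definition shift n (v : nat -> int) (i : nat) : int :=
  (if (i < n)%N then v i.+1 else 0) + 2 * v 0%N.

(* Coordinate vectors are functions on [nat], relevant only up to index [n];
   [n] is one less than the rank [d]. *)
Definition value (F : nzRingType) n (a : F) (v : nat -> int) : F :=
  \sum_(i < n.+1) (v i)%:~R * a ^+ i.

Definition halving_root (F : nzRingType) n (a : F) : Prop :=
  2 * (\sum_(i < n.+1) a ^+ i.+1) = 1.

Section Shift.
Variables (F : comNzRingType) (n : nat) (a : F).
Hypothesis ha : halving_root n a.

Lemma value_shift v : a * value n a (shift n v) = value n a v.
Proof.
rewrite mulr_sumr (eq_bigr (fun i : 'I_n.+1 =>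
    (if (i < n)%N then v i.+1 else 0)%:~R * a ^+ i.+1
    + (v 0%N)%:~R * (2 * a ^+ i.+1))); last first.
  by move=> i _; rewrite /shift rmorphD rmorphM /= exprS; ring.
rewrite big_split /= -!mulr_sumr ha mulr1 big_ord_recr /= ltnn mul0r addr0.
rewrite /value big_ord_recl expr0 mulr1 addrC; congr (_ + _).
by apply: eq_bigr => i _; rewrite ltn_ord.
Qed.

Lemma value_iter_shift k v :
  a ^+ k * value n a (iter k (shift n) v) = value n a v.
Proof.
elim: k => [|k IHk]; first by rewrite mul1r.
by rewrite exprSr -mulrA iterS value_shift.
Qed.

Lemma valueD u v :
  value n a (fun i => u i + v i) = value n a u + value n a v.
Proof. by rewrite -big_split; apply: eq_bigr => i _; rewrite rmorphD mulrDl. Qed.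

Lemma value_const c : value n a (fun i => if i == 0%N then c else 0) = c%:~R.
Proof.
rewrite /value big_ord_recl mulr1 big1 ?addr0 // => i _.
by rewrite mul0r.
Qed.

(** Induction along Horner's scheme: multiplication by [a] raises the exponent to [k.+1], and the
    added constant is shifted [k.+1] times to carry the same power. All large [k] are allowed so
    that finitely many elements can share one exponent. *)
Lemma horner_value (f : {poly int}) :
  exists k0, forall k, (k0 <= k)%N ->
    exists v, (map_poly intr f).[a] = a ^+ k * value n a v.
Proof.
elim/poly_ind: f => [|f c [k0 IHf]].
  exists 0%N => k _; exists (fun=> 0); rewrite rmorph0 horner0 /value big1 ?mulr0 // => i _.
  by rewrite mul0r.
exists k0.+1 => -[//|k] /IHf[v fv].
exists (fun i => v i + iter k.+1 (shift n) (fun i => if i == 0%N then c else 0) i).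
rewrite valueD mulrDr value_iter_shift value_const.
by rewrite rmorphD rmorphM /= map_polyX map_polyC hornerMXaddC fv exprSr; ring.
Qed.

End Shift.

(** * Contraction of coordinates towards the positive eigenvector *)

Lemma exprn_small (R : archiRealFieldType) (x C e : R) : 0 < x <= 1 -> 0 <= C -> 0 < e ->
  exists k, (1 - x) ^+ k * C < e.
Proof.
move=> /andP[x_gt0 x_le1] C0 e0.
(* A form of Bernoulli's inequality, with the geometric decay bounded by [1 / (1 + k x)]. *)
have bern k : (1 - x) ^+ k * (1 + k%:R * x) <= 1.
  elim: k => [|k IHk]; first by rewrite expr0 mul0r addr0 mulr1.
  apply: le_trans IHk; rewrite exprSr -mulrA ler_wpM2l ?exprn_ge0 ?subr_ge0 //.
  have : 0 <= k%:R :> R by [].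
  rewrite -natr1; move: (k%:R : R) => K K0; nra.
have := archi_boundP (divr_ge0 C0 (ltW (mulr_gt0 e0 x_gt0))).
set k := Num.bound _ => hk; exists k.
have hC : C < e * (1 + k%:R * x).
  by move: hk; rewrite ltr_pdivrMr ?mulr_gt0 //; nra.
have : 0 <= (1 - x) ^+ k by rewrite exprn_ge0 ?subr_ge0.
rewrite le_eqVlt => /orP[/eqP<-|p0].
  by rewrite mul0r.
rewrite (lt_le_trans (_ : _ < (1 - x) ^+ k * (e * (1 + k%:R * x)))) ?ltr_pM2l //.
by rewrite mulrCA ger_pMr.
Qed.

Section Contraction.
Variables (R : archiRealFieldType) (n : nat) (a : R).
Hypotheses (ha : halving_root n a) (a_gt0 : 0 < a).

Definition tail_sum (i : nat) : R := \sum_(j < n.+1 - i) a ^+ j.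

Lemma tail_sumS i : (i <= n)%N -> tail_sum i = 1 + a * tail_sum i.+1.
Proof.
move=> le_in; rewrite /tail_sum subSn // big_ord_recl subSS mulr_sumr.
by congr (_ + _); apply: eq_bigr => j _; rewrite exprS.
Qed.

Lemma tail_sum_ge0 i : 0 <= tail_sum i.
Proof. by apply: sumr_ge0 => j _; rewrite exprn_ge0 ?ltW. Qed.

Lemma tail_sum_ge1 i : (i <= n)%N -> 1 <= tail_sum i.
Proof. by move/tail_sumS->; rewrite lerDl mulr_ge0 ?tail_sum_ge0 ?ltW. Qed.

Lemma tail_sum_n1 : tail_sum n.+1 = 0.
Proof. by rewrite /tail_sum subnn big_ord0. Qed.

Lemma tail_sum0 : 2 * a * tail_sum 0 = 1.
Proof.
rewrite -[RHS]ha -mulrA /tail_sum subn0; congr (_ * _); rewrite mulr_sumr.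
by apply: eq_bigr => i _; rewrite exprS.
Qed.

Lemma tail_sum_le0 i : tail_sum i <= tail_sum 0.
Proof.
rewrite /tail_sum subn0 -!(big_mkord predT (fun j => a ^+ j)).
rewrite [leRHS](big_cat_nat (n := n.+1 - i)) ?leq_subr //= lerDl.
by apply: sumr_ge0 => j _; rewrite exprn_ge0 ?ltW.
Qed.

(** By [tail_sum0] this is the inverse of [tail_sum 0], so it is the least of the transition
    probabilities [1 / tail_sum i] to 0. *)
Let q := 2 * a.

Lemma contraction_rate : 0 < q <= 1.
Proof.
rewrite mulr_gt0 //= -tail_sum0 ler_peMr ?tail_sum_ge1 //.
by rewrite mulr_ge0 ?ltW.
Qed.

(* Doeblin's argument: [tail_sum] is a right eigenvector of [shift] for the
   eigenvalue [1/a]; dividing by it turns [shift] into a Markov operator whose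
   transition probabilities to [0] are all at least [q]. *)
Lemma shift_contraction k v : exists m,
  forall i, (i <= n)%N ->
  m * tail_sum i <= a ^+ k * (iter k (shift n) v i)%:~R
  <= (m + (1 - q) ^+ k * (2 * \sum_(j < n.+1) `|(v j)%:~R|)) * tail_sum i.
Proof.
set D := \sum_(j < _) _.
have [q_gt0 q_le1] := andP contraction_rate.
have q0 : q * tail_sum 0 = 1 by exact: tail_sum0.
have t0 : 1 <= tail_sum 0 by exact: tail_sum_ge1.
elim: k => [|k [m IHk]].
  (* Since [tail_sum i] is at least 1, all normalised coordinates start in [[-D, D]], of width
     [2 * D]. *)
  exists (- D) => i le_in; rewrite !mul1r /=.
  have vD : `|(v i)%:~R| <= D * tail_sum i.
    apply: le_trans (_ : D <= _); last first.
      by rewrite ler_peMr ?tail_sum_ge1 ?sumr_ge0.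
    have lt_in : (i < n.+1)%N by [].
    by rewrite /D (bigD1 (Ordinal lt_in)) //= lerDl sumr_ge0.
  by move: vD; rewrite ler_norml; lra.
set e := _ * (2 * D) in IHk.
set w := fun i => a ^+ k * (iter k (shift n) v i)%:~R in IHk.
(* The normalised coordinate at 0, namely [w 0 / tail_sum 0]. *)
pose z0 := q * w 0%N.
have /andP[w0m w0M] : m * tail_sum 0 <= w 0%N <= (m + e) * tail_sum 0 by exact: IHk.
have w0E : w 0%N = z0 * tail_sum 0.
  by rewrite /z0 mulrAC q0 mul1r.
have z0m : m <= z0 by rewrite -(ler_pM2r (lt_le_trans ltr01 t0)) -w0E.
have z0M : z0 <= m + e by rewrite -(ler_pM2r (lt_le_trans ltr01 t0)) -w0E.
(* Each new normalised coordinate is an average giving weight at least [q] to [z0], the rest lying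
   in [[m, m + e]]; the width shrinks by [1 - q]. *)
exists (q * z0 + (1 - q) * m) => i le_in.
have -> : a ^+ k.+1 * (iter k.+1 (shift n) v i)%:~R
  = a * (if (i < n)%N then w i.+1 else 0) + z0.
  rewrite /z0 /q /w iterS /shift rmorphD rmorphM /= exprS.
  by case: ifP => _; ring.
have -> : (1 - q) ^+ k.+1 * (2 * D) = (1 - q) * e by rewrite exprS -mulrA.
have /andP[wi wI] : m * tail_sum i.+1 <= (if (i < n)%N then w i.+1 else 0)
     <= (m + e) * tail_sum i.+1.
  have [lt_in|le_ni] := ltnP i n; first exact: IHk.
  have -> : i = n by apply/eqP; rewrite eqn_leq le_in le_ni.
  by rewrite tail_sum_n1 !mulr0 lexx.
have ti := tail_sumS le_in.
have qt : q * tail_sum i <= 1 by rewrite -q0 ler_pM2l ?tail_sum_le0.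
move: wi wI; set y := (if _ then _ else _) => wi wI.
have {}wi : m * (tail_sum i - 1) <= a * y.
  by rewrite ti [1 + _]addrC addrK mulrCA ler_pM2l.
have {}wI : a * y <= (m + e) * (tail_sum i - 1).
  by rewrite ti [1 + _]addrC addrK [leRHS]mulrCA ler_pM2l.
(* The weight of [z0] beyond [q], multiplied by [tail_sum i], is [1 - q * tail_sum i]; it can only
   push away from either endpoint. *)
have h1 : 0 <= (1 - q * tail_sum i) * (z0 - m).
  by rewrite mulr_ge0 ?subr_ge0.
have h2 : 0 <= (1 - q * tail_sum i) * (m + e - z0).
  by rewrite mulr_ge0 ?subr_ge0.
by apply/andP; split; move: wi wI h1 h2; clear; move: (q) (tail_sum i) (z0) (e) (a * y) => p t z f x; nra.
Qed.

(** The value is a positive combination of the rescaled coordinates and stays fixed under iteration,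
    while their normalised spread tends to 0. Once the spread is below [value n a v / S], the lower
    bound [m] must be positive. *)
Lemma shift_eventually_ge0 v : 0 < value n a v ->
  exists k, forall i, (i <= n)%N -> 0 <= iter k (shift n) v i.
Proof.
move=> v_gt0.
pose S := \sum_(i < n.+1) tail_sum i * a ^+ i.
have S_gt0 : 0 < S.
  rewrite /S big_ord_recl mulr1 ltr_wpDr ?(lt_le_trans ltr01) ?tail_sum_ge1 //.
  by apply: sumr_ge0 => i _; rewrite mulr_ge0 ?tail_sum_ge0 ?exprn_ge0 ?ltW.
pose D : R := 2 * \sum_(j < n.+1) `|(v j)%:~R|.
have D_ge0 : 0 <= D by rewrite mulr_ge0 ?sumr_ge0.
have [k hk] := exprn_small contraction_rate D_ge0 (divr_gt0 v_gt0 S_gt0).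
have [m hm] := shift_contraction k v.
exists k => i le_in.
have {hk} m_gt0 : 0 < m.
  suff : value n a v <= (m + (1 - q) ^+ k * D) * S.
    by rewrite -ler_pdivrMr // => /(lt_le_trans hk); rewrite ltrDr.
  rewrite -(value_iter_shift ha k) /value !mulr_sumr; apply: ler_sum => j _.
  rewrite !mulrA ler_wpM2r ?exprn_ge0 ?(ltW a_gt0) //.
  by rewrite -[_ * 2 * _]mulrA; have /andP[] := hm j (leq_ord j).
have /andP[h _] := hm i le_in.
have : 0 <= a ^+ k * (iter k (shift n) v i)%:~R.
  by apply: le_trans h; rewrite mulr_ge0 ?tail_sum_ge0 ?ltW.
by rewrite pmulr_rge0 ?exprn_gt0 // ler0z.
Qed.

End Contraction.

(** * Existence of the positive real root *)

Lemma halving_root_exists (R : rcfType) n :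
  exists2 a : R, 0 < a & halving_root n a.
Proof.
pose p : {poly R} := 2 *: (\sum_(i < n.+1) 'X^(i.+1)) - 1.
have pE x : p.[x] = 2 * (\sum_(i < n.+1) x ^+ i.+1) - 1.
  rewrite /p !hornerE horner_sum; congr (_ * _ - _).
  by apply: eq_bigr => i _; rewrite hornerXn.
have p0 : p.[0] = -1.
  by rewrite pE big1 ?mulr0 ?sub0r // => i _; rewrite expr0n.
have p1 : 0 <= p.[1].
  rewrite pE big_ord_recl expr1 subr_ge0.
  set s := \sum_(_ < _) _.
  have : 0 <= s by apply: sumr_ge0 => i _; rewrite exprn_ge0.
  by lra.
have [||a /andP[a_ge0 _] /rootP pa] := @Num.Theory.poly_ivt _ p 0 1.
- exact: ler01.
- by rewrite p0 lerN10.
exists a; last by apply/eqP; rewrite -subr_eq0 -pE pa.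
rewrite lt_neqAle a_ge0 andbT eq_sym; apply: contra_eqT pa => /negbNE/eqP->.
by rewrite p0 oppr_eq0 oner_eq0.
Qed.

(** * Irreducibility and independence of the powers of [a] *)

Definition eisenstein_poly n : {poly int} :=
  'X^(n.+1) + \poly_(i < n.+1) (-2).

Lemma size_eisenstein_poly n : size (eisenstein_poly n) = n.+2.
Proof. by rewrite size_polyDl ?size_polyXn // ltnS size_poly. Qed.

Lemma eisenstein_poly_irreducible n :
  irreducible_poly (map_poly intr (eisenstein_poly n) : {poly rat}).
Proof.
apply/irreducible_rat_int.
have c i : (i < n.+1)%N -> (eisenstein_poly n)`_i = -2.
  by move=> lt_in; rewrite coefD coefXn coef_poly lt_in ltn_eqF // add0r.
apply: (@eisenstein_crit 2); rewrite ?size_eisenstein_poly //.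
- by rewrite lead_coefE size_eisenstein_poly coefD coefXn coef_poly eqxx ltnn.
- by rewrite c.
- by move=> i /c ->.
Qed.

Section Independence.
Variables (F : numFieldType) (n : nat) (a : F).
Hypothesis ha : halving_root n a.

Lemma halving_root_neq0 : a != 0.
Proof.
apply/eqP => a0; have := ha; rewrite /halving_root a0 big1 ?mulr0.
  by move/eqP; rewrite eq_sym oner_eq0.
by move=> i _; rewrite expr0n.
Qed.

Lemma root_eisenstein_poly : root (map_poly intr (eisenstein_poly n)) a^-1.
Proof.
have a0 := halving_root_neq0.
rewrite /eisenstein_poly rmorphD /= map_polyXn; apply/rootP.
rewrite hornerD hornerXn (@horner_coef_wide _ n.+1); last first.
  by rewrite (leq_trans (size_poly _ _)) // size_poly.
(* Multiplying by [a^(n+1)] reverses the exponents and gives back the halving equation. *)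
apply: (mulfI (expf_neq0 n.+1 a0)).
rewrite mulr0 mulrDr -exprMn divff // expr1n -[X in X + _](ha).
rewrite (reindex_inj rev_ord_inj) /= !mulr_sumr -big_split /= big1 // => i _.
rewrite coef_map coef_poly ltn_ord /= subSS.
have le_in := leq_ord i.
have -> : a ^+ n.+1 = a ^+ (n - i).+1 * a ^+ i by rewrite -exprD addSn subnK.
by rewrite exprVn [_ / _]mulrC mulrA mulfK ?expf_neq0 // mulrC -mulrDr rmorphN addrN mulr0.
Qed.

(** Reversing the coefficients gives a rational polynomial of degree at most [n] vanishing at
    [a^-1]. If nonzero, it would be coprime to the irreducible Eisenstein polynomial of degree
    [n+1], yet share that root. *)
Lemma value_eq0 (v : nat -> int) :
  value n a v = 0 -> forall i, (i <= n)%N -> v i = 0.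
Proof.
move=> v0.
pose h : {poly rat} := \poly_(i < n.+1) (v (n - i)%N)%:~R.
have a0 := halving_root_neq0.
have ha0 : (map_poly ratr h).[a^-1] = 0.
  apply: (mulfI (expf_neq0 n a0)); rewrite mulr0 -[RHS]v0 /value.
  rewrite (@horner_coef_wide _ n.+1) ?size_map_poly ?size_poly //.
  rewrite [RHS](reindex_inj rev_ord_inj) /= mulr_sumr; apply: eq_bigr => i _.
  rewrite coef_map coef_poly ltn_ord /= ratr_int subSS.
  have le_in := leq_ord i.
  have -> : a ^+ n = a ^+ (n - i) * a ^+ i by rewrite -exprD subnK.
  by rewrite exprVn -mulrA [_ * (_ / _)]mulrCA divff ?expf_neq0 // mulr1 mulrC.
have h0 : h = 0.
  apply/eqP; apply: contra_eqT ha0 => hn0.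
  have cop : coprimep (map_poly intr (eisenstein_poly n)) h.
    rewrite irreducible_poly_coprime; last exact: eisenstein_poly_irreducible.
    apply/negP => /(dvdp_leq hn0).
    rewrite (size_map_inj_poly intr_inj (mulr0z _)) size_eisenstein_poly.
    by move/leq_trans/(_ (size_poly _ _)); rewrite ltnn.
  move: cop; rewrite -(coprimep_map (ratr : {rmorphism rat -> F})).
  move=> /coprimep_root; apply.
  rewrite -map_poly_comp (eq_map_poly (ratr_int _)); exact: root_eisenstein_poly.
move=> i le_in; have /polyP/(_ (n - i)%N) := h0.
by rewrite coef_poly ltnS leq_subr coef0 subKn // => /eqP; rewrite intr_eq0 => /eqP.
Qed.

End Independence.

(** * Integer linear relations *)

Lemma rat_common_denominator m (x : 'rV[rat]_m) :
  exists2 c : int, c != 0 & exists k : 'I_m -> int, forall j, c%:~R * x 0 j = (k j)%:~R.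
Proof.
exists (\prod_j denq (x 0 j)).
  by apply/prodf_neq0 => j _; apply: denq_neq0.
exists (fun j => numq (x 0 j) * \prod_(l < m | l != j) denq (x 0 l)) => j.
rewrite (bigD1 j) //= !rmorphM /= mulrAC mulrC -[X in _ * (_ * X)]divq_num_den.
rewrite mulrC; congr (_ * _).
by rewrite mulrC divfK // intr_eq0 denq_neq0.
Qed.

(** A rational matrix with more rows than columns has a nonzero left kernel vector; clearing
    denominators makes it integral. *)
Lemma int_dependence m n (u : 'I_m -> 'I_n -> int) : (n < m)%N ->
  exists2 k : 'I_m -> int, (exists i, k i != 0) &
    forall j, \sum_i k i * u i j = 0.
Proof.
move=> lt_nm.
pose A : 'M[rat]_(m, n) := \matrix_(i, j) (u i j)%:~R.
have : kermx A != 0.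
  rewrite kermx_eq0 -row_leq_rank -ltnNge.
  exact: leq_ltn_trans (rank_leq_col A) lt_nm.
case/rowV0Pn => x /sub_kermxP xA xn0.
have [c c0 [k kE]] := rat_common_denominator x.
exists k.
  have /rV0Pn[j xj] := xn0; exists j.
  by rewrite -(intr_eq0 rat) -kE mulf_neq0 ?intr_eq0.
move=> j; apply/eqP; rewrite -(intr_eq0 rat) rmorph_sum /=; apply/eqP.
transitivity (c%:~R * (x *m A) 0 j); last by rewrite xA mxE mulr0.
rewrite mxE mulr_sumr; apply: eq_bigr => i _.
by rewrite rmorphM /= -kE mxE mulrA.
Qed.

(** * Atoms, units and rank of the evaluation monoid *)

Section EvaluationMonoid.
Variables (F : numFieldType) (n : nat) (a : F).
Hypotheses (ha : halving_root n a) (a_gt0 : 0 < a).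

Lemma evaluation_monoidP x :
  evaluation_monoid a x <->
  exists m (c : nat -> nat), x = \sum_(i < m) (c i)%:R * a ^+ i.
Proof.
split=> [[p _ <-]|[m [c ->]]].
  exists (size p), (fun i => p`_i); rewrite (@horner_coef_wide _ (size p)) ?size_poly //.
  by apply: eq_bigr => i _; rewrite coef_map_id0.
exists (\poly_(i < m) c i) => //.
rewrite (@horner_coef_wide _ m); last first.
  exact: leq_trans (size_poly _ _) (size_poly _ _).
by apply: eq_bigr => i _; rewrite coef_map_id0 // coef_poly ltn_ord.
Qed.

Lemma evaluation_monoid_sum (I : Type) (r : seq I) (P : pred I) (f : I -> F) :
  (forall i, P i -> evaluation_monoid a (f i)) ->
  evaluation_monoid a (\sum_(i <- r | P i) f i).
Proof.
have [M0 MD] := submonoid_evaluation_monoid a.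
by move=> Mf; elim/big_ind: _.
Qed.

Lemma evaluation_monoid_monomial c i : evaluation_monoid a (c%:R * a ^+ i).
Proof.
apply/evaluation_monoidP; exists i.+1, (fun j => if j == i then c else 0%N).
rewrite big_ord_recr /= eqxx big1 ?add0r // => j _.
by rewrite ltn_eqF // mul0r.
Qed.

Lemma evaluation_monoid_value k v : (forall i, (i <= n)%N -> 0 <= v i) ->
  evaluation_monoid a (a ^+ k * value n a v).
Proof.
move=> v_ge0; rewrite mulr_sumr; apply: evaluation_monoid_sum => i _.
rewrite mulrCA -exprD.
case: (v i) (v_ge0 i (leq_ord i)) => // m _.
rewrite -pmulrn; exact: evaluation_monoid_monomial.
Qed.

Lemma evaluation_monoid_ge0 x : evaluation_monoid a x -> 0 <= x.
Proof.
case/evaluation_monoidP => m [c ->]; apply: sumr_ge0 => i _.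
by rewrite mulr_ge0 ?exprn_ge0 ?(ltW a_gt0).
Qed.

Lemma evaluation_monoid_invertible x :
  minvertible (evaluation_monoid a) x -> x = 0.
Proof.
case=> /evaluation_monoid_ge0 x_ge0 [y /evaluation_monoid_ge0 y_ge0] /eqP.
by rewrite paddr_eq0 // => /andP[/eqP].
Qed.

Lemma evaluation_monoid_not_group : ~ is_group (evaluation_monoid a).
Proof.
have M1 : evaluation_monoid a 1.
  by have := evaluation_monoid_monomial 1 0; rewrite mulr1.
move=> /(_ 1 M1)/evaluation_monoid_invertible/eqP.
by rewrite oner_eq0.
Qed.

Lemma evaluation_monoid_antimatter : antimatter (evaluation_monoid a).
Proof.
have [M0 MD] := submonoid_evaluation_monoid a.
move=> x [Mx xninv xatom].
have x0 : x <> 0.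
  by move=> x0; apply: xninv; split=> //; exists 0; rewrite // x0 addr0.
have [m [c xE]] := (evaluation_monoidP x).1 Mx.
have /existsP[j cj] : [exists j : 'I_m, (0 < c j)%N].
  apply: contra_notT x0; rewrite negb_exists => /forallP c0.
  rewrite xE big1 // => i _; move: (c0 i); rewrite -eqn0Ngt => /eqP->.
  by rewrite mul0r.
(* [y] is [x] with one copy of [a^j] removed. [z] is the rest of [a^j] after splitting off one of
   its two copies of [a^(j+1)]; the other copy keeps [z] nonzero even when [n = 0]. *)
pose y := (c j).-1%:R * a ^+ j + \sum_(i < m | i != j) (c i)%:R * a ^+ i.
pose z := a ^+ j.+1 + \sum_(i < n) 2 * a ^+ (j + i.+2).
have Mpow i : evaluation_monoid a (a ^+ i).
  by have := evaluation_monoid_monomial 1 i; rewrite mul1r.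
have My : evaluation_monoid a y.
  apply: MD; first exact: evaluation_monoid_monomial.
  by apply: evaluation_monoid_sum => i _; apply: evaluation_monoid_monomial.
have Mz : evaluation_monoid a z.
  apply: MD; first exact: Mpow.
  by apply: evaluation_monoid_sum => i _; apply: evaluation_monoid_monomial.
have ajE : a ^+ j = a ^+ j.+1 + z.
  rewrite -[LHS]mulr1 -[X in _ * X](ha) big_ord_recl /z addrA.
  rewrite !mulrDr; congr (_ + _); first by rewrite expr1 !exprSr; ring.
  by rewrite !mulr_sumr; apply: eq_bigr => i _; rewrite exprD; ring.
have xE' : x = a ^+ j.+1 + (z + y).
  rewrite addrA -ajE /y addrA -{1}[a ^+ j]mul1r -mulrDl nat1r prednK //.
  by rewrite xE (bigD1 j).
have [||/evaluation_monoid_invertible/eqP|/evaluation_monoid_invertible/eqP] :=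
  xatom _ _ _ _ xE'.
- exact: Mpow.
- exact: MD.
- by rewrite expf_eq0 gt_eqF.
- rewrite /z paddr_eq0 ?evaluation_monoid_ge0 // paddr_eq0 ?exprn_ge0 ?(ltW a_gt0) //.
    by rewrite expf_eq0 (gt_eqF a_gt0).
  by apply: sumr_ge0 => i _; rewrite mulr_ge0 ?exprn_ge0 ?(ltW a_gt0).
Qed.

Lemma evaluation_monoid_coordinates x : evaluation_monoid a x ->
  exists k0, forall k, (k0 <= k)%N -> exists v, x = a ^+ k * value n a v.
Proof.
case=> p _ <-.
have -> : map_poly (fun m : nat => m%:R : F) p
        = map_poly intr (map_poly Posz p).
  by apply/polyP => i; rewrite coef_map !coef_map_id0.
exact: horner_value.
Qed.

Lemma difference_group_coordinates x : difference_group (evaluation_monoid a) x ->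
  exists k0, forall k, (k0 <= k)%N -> exists v, x = a ^+ k * value n a v.
Proof.
case=> y /evaluation_monoid_coordinates[k1 hy].
case=> z /evaluation_monoid_coordinates[k2 hz] <-.
exists (maxn k1 k2) => k; rewrite geq_max => /andP[/hy[u ->] /hz[v ->]].
exists (fun i => u i - v i); rewrite -mulrBr; congr (_ * _).
by rewrite /value -sumrB; apply: eq_bigr => i _; rewrite rmorphB mulrBl.
Qed.

(** The powers [1, ..., a^n] are free by [value_eq0]. Conversely, finitely many differences have
    integer coordinates over a common [a^k], so more than [n+1] of them satisfy an integer
    relation. *)
Lemma evaluation_monoid_rank : has_rank (evaluation_monoid a) n.+1.
Proof.
have [M0 MD] := submonoid_evaluation_monoid a.
split.
  exists (fun i : 'I_n.+1 => a ^+ i).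
    move=> i; exists (a ^+ i); last by exists 0; rewrite ?subr0.
    by have := evaluation_monoid_monomial 1 i; rewrite mul1r.
  move=> k k0 i; rewrite -(inord_val i).
  apply: (value_eq0 ha (v := fun j => k (inord j))) (leq_ord i).
  rewrite -[RHS]k0; apply: eq_bigr => j _.
  by rewrite inord_val mulrC mulrzr.
move=> m v Gv freev; rewrite leqNgt; apply/negP => lt_nm.
have [K hK] := choice (fun i => difference_group_coordinates (Gv i)).
pose k := \max_i K i.
have /choice[u uE] : forall i, exists u, v i = a ^+ k * value n a u.
  by move=> i; apply: hK; rewrite /k leq_bigmax.
have [c [i ci] c0] := int_dependence (fun i (j : 'I_n.+1) => u i j) lt_nm.
apply/negP: ci; rewrite negbK; apply/eqP; apply: freev.
transitivity (a ^+ k * \sum_(j < n.+1) (\sum_i c i * u i j)%:~R * a ^+ j); last first.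
  by rewrite big1 ?mulr0 // => j _; rewrite c0 mul0r.
rewrite (eq_bigr (fun j : 'I_n.+1 => \sum_i (c i * u i j)%:~R * a ^+ j)); last first.
  by move=> j _; rewrite rmorph_sum mulr_suml.
rewrite exchange_big mulr_sumr; apply: eq_bigr => l _.
rewrite uE -mulrzr -mulrA; congr (_ * _); rewrite mulr_suml.
by apply: eq_bigr => j _; rewrite rmorphM /= mulrC mulrA.
Qed.

Lemma halving_root_algebraic : algebraicOver (ratr : rat -> F) a.
Proof.
rewrite -[a]invrK; apply: algebraic_inv.
exists (map_poly intr (eisenstein_poly n)).
  exact: irredp_neq0 (eisenstein_poly_irreducible n).
rewrite -map_poly_comp (eq_map_poly (ratr_int _)).
exact: root_eisenstein_poly.
Qed.

End EvaluationMonoid.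

Lemma rmorph_value (F K : nzRingType) (f : {rmorphism F -> K}) n (a : F) v :
  value n (f a) v = f (value n a v).
Proof.
by rewrite rmorph_sum; apply: eq_bigr => i _; rewrite rmorphM rmorphXn /= rmorph_int.
Qed.

Lemma rmorph_halving_root (F K : nzRingType) (f : {rmorphism F -> K}) n (a : F) :
  halving_root n a -> halving_root n (f a).
Proof.
move=> ha; rewrite /halving_root -[RHS](rmorph1 f) -[in RHS]ha rmorphM rmorph_nat.
by rewrite rmorph_sum; congr (_ * _); apply: eq_bigr => i _; rewrite rmorphXn.
Qed.

(** * Divisibility decided by sign in the real field *)

Section Valuation.
Variables (R : archiRealFieldType) (F : numFieldType) (f : {rmorphism R -> F}).
Variables (n : nat) (a : R).
Hypotheses (ha : halving_root n a) (a_gt0 : 0 < a).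

(** Positivity is tested in [R], where the contraction argument applies; the integer coordinates it
    yields are then used unchanged in [F]. *)
Lemma evaluation_monoid_pos k v : 0 < value n a v ->
  evaluation_monoid (f a) (f a ^+ k * value n (f a) v).
Proof.
case/(shift_eventually_ge0 ha a_gt0) => l /(evaluation_monoid_value (f a) (k + l)).
by rewrite exprD -mulrA value_iter_shift //; apply: rmorph_halving_root.
Qed.

Lemma evaluation_monoid_valuation : valuation_monoid (evaluation_monoid (f a)).
Proof.
have ha' := rmorph_halving_root f ha.
move=> x y Mx My.
have [k0 /(_ k0 (leqnn _))[v xyE]] : exists k0, forall k, (k0 <= k)%N ->
    exists v, x - y = f a ^+ k * value n (f a) v.
  by apply: difference_group_coordinates => //; exists x => //; exists y.
(* The order of [F] may be partial, so [x - y] is compared with 0 through the real number having the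
   same coordinates. *)
have [v_lt0|v_gt0|v0] := ltgtP (value n a v) 0.
- right; exists (y - x); last by rewrite addrC subrK.
  have vN : value n a (fun i => - v i) = - value n a v.
    by rewrite /value -sumrN; apply: eq_bigr => i _; rewrite rmorphN mulNr.
  have := @evaluation_monoid_pos k0 (fun i => - v i).
  by rewrite rmorph_value vN oppr_gt0 rmorphN -rmorph_value mulrN -xyE opprB; apply.
- left; exists (x - y); last by rewrite addrC subrK.
  by rewrite xyE; apply: evaluation_monoid_pos.
- left; exists 0; first by case: (submonoid_evaluation_monoid (f a)).
  by apply/eqP; rewrite addr0 -subr_eq0 xyE rmorph_value v0 rmorph0 mulr0.
Qed.

End Valuation.

Theorem proposition5p1 (R : realType) (d : nat) (hd : (0 < d)%N) :
  exists alpha : R[i],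
    algebraicOver (ratr : rat -> R[i]) alpha /\
    [/\ antimatter (evaluation_monoid alpha),
        valuation_monoid (evaluation_monoid alpha),
        has_rank (evaluation_monoid alpha) d &
        ~ is_group (evaluation_monoid alpha)].
Proof.
case: d hd => // n _.
have [a a_gt0 ha] := halving_root_exists R n.
pose f : {rmorphism R -> R[i]} := real_complex R.
have hfa := rmorph_halving_root f ha.
have fa_gt0 : 0 < f a by rewrite ltcR.
exists (f a); split; first exact: halving_root_algebraic hfa.
split.
- exact: evaluation_monoid_antimatter hfa fa_gt0.
- exact: evaluation_monoid_valuation ha a_gt0.
- exact: evaluation_monoid_rank hfa.
- exact: evaluation_monoid_not_group fa_gt0.
Qed.
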